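(* Let $G$ be a random graph drawn under the $G(n,p)$ model, where $p=p(n)$ satisfies $\frac{2\log n}{n} < p < \frac{1}{\log^2 n}$. Then there is a constant $C>0$ such that, asymptotically almost surely, $$\varphi(G) \geq \hat{\varphi}(G) \geq \chi(G)\left(1-\frac{C}{\log (np)}\right).$$
   Context: All graphs are finite, simple and undirected. $\chi$ denotes the chromatic number. For a proper vertex coloring $c$ of $G$ and an induced subgraph $H$ of $G$, let $c(H)$ be the set of colors used by $c$ on the vertices of $H$. Define $\varphi_c(G)=\max_{H}\,(|c(H)|-\chi(H))$ over all induced subgraphs $H$ of $G$, and $\hat{\varphi}_c(G)$ as the same maximum taken only over all connected induced subgraphs $H$ of $G$. Define $\varphi(G)=\min_c \varphi_c(G)$ and $\hat{\varphi}(G)=\min_c \hat{\varphi}_c(G)$, the minima over all proper colorings $c$ of $G$ (with any number of colors). $G(n,p)$ is the Erdős–Rényi model: a random graph on $n$ labelled vertices in which each pair of vertices is an edge independently with probability $p$. An event occurs asymptotically almost surely (a.a.s.) if its probability tends to $1$ as $n\to\infty$. $\log$ is the natural logarithm and $\log^2 n=(\log n)^2$. *)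

(* Defs.v *)
From mathcomp Require Import all_boot all_order all_algebra.
From mathcomp Require Import all_classical all_reals all_analysis.
Set Implicit Arguments.
Unset Strict Implicit.
Unset Printing Implicit Defensive.
Import Order.TTheory GRing.Theory Num.Theory.
Import numFieldNormedType.Exports.

Local Open Scope nat_scope.

Record sgraph (T : Type) := SGraph {
  adj : rel T;
  adj_sym : symmetric adj;
  adj_irr : irreflexive adj
}.

Section Graphs.
Variable T : finType.
Implicit Types (G : sgraph T) (S : {set T}).

Definition proper_coloring (K : eqType) G (c : T -> K) : bool :=
  [forall x, forall y, adj G x y ==> (c x != c y)].

Definition colorable G (k : nat) : bool :=
  [exists c : {ffun T -> 'I_k}, proper_coloring G c].

Lemma proper_inj (K : eqType) G (c : T -> K) :
  injective c -> proper_coloring G c.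
Proof.
move=> cI; apply/forallP => x; apply/forallP => y; apply/implyP => xy.
by apply: contraTneq xy => /cI ->; rewrite adj_irr.
Qed.

Lemma ex_colorable G : exists k, colorable G k.
Proof.
exists #|T|; apply/existsP; exists [ffun x => enum_rank x].
by apply: proper_inj => x y; rewrite !ffunE => /enum_rank_inj.
Qed.

Definition chi G : nat := ex_minn (ex_colorable G).

Definition graph_connected G : bool :=
  (0 < #|T|) && [forall x, forall y, connect (adj G) x y].

Definition ncolors (c : T -> nat) S : nat := size (undup [seq c x | x in S]).

Definition induced G S : sgraph {x : T | x \in S} :=
  SGraph (adj := fun x y => adj G (val x) (val y))
    (fun x y => adj_sym G (val x) (val y)) (fun x => adj_irr G (val x)).

End Graphs.

(* The truncated subtraction in [phi_col] and [phihat_col] below is exact. *)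
Lemma chi_induced_le (T : finType) (G : sgraph T) (c : T -> nat) (S : {set T}) :
  proper_coloring G c -> chi (induced G S) <= ncolors c S.
Proof.
move=> cP; rewrite /chi; case: ex_minnP => k _; apply.
have cS (x : {x : T | x \in S}) :
    index (c (val x)) (undup [seq c x | x in S]) < ncolors c S.
  by rewrite index_mem mem_undup; apply: map_f; rewrite mem_enum; exact: valP.
apply/existsP; exists [ffun x => Ordinal (cS x)].
apply/forallP => x; apply/forallP => y; apply/implyP => xy; rewrite !ffunE.
move/forallP/(_ (val x))/forallP/(_ (val y))/implyP/(_ xy) : cP.
apply: contraNneq => /(congr1 val) /= exy.
have cm (z : {x : T | x \in S}) : c (val z) \in undup [seq c x | x in S].
  by rewrite mem_undup; apply: map_f; rewrite mem_enum; exact: valP.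
by apply/eqP; rewrite -(nth_index 0 (cm x)) exy (nth_index 0 (cm y)).
Qed.

Section Phi.
Variable T : finType.
Implicit Types (G : sgraph T) (c : T -> nat).

Definition phi_col G c : nat :=
  \max_(S : {set T}) (ncolors c S - chi (induced G S)).

Definition phihat_col G c : nat :=
  \max_(S : {set T} | graph_connected (induced G S))
     (ncolors c S - chi (induced G S)).

Lemma ex_col_value G (f : (T -> nat) -> nat) :
  exists k, `[< exists2 c, proper_coloring G c & f c = k >].
Proof.
pose c0 (x : T) : nat := enum_rank x.
exists (f c0); apply/asboolP; exists c0 => //.
by apply: proper_inj => x y /val_inj /enum_rank_inj.
Qed.

(* The minimum of [f] over all proper colorings, with arbitrarily many colors. *)
Definition min_col G (f : (T -> nat) -> nat) : nat := ex_minn (ex_col_value G f).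

Definition phi G : nat := min_col G (phi_col G).
Definition phihat G : nat := min_col G (phihat_col G).

End Phi.

Section EdgeSet.
Variables (T : finType) (E : {set {set T}}).

Definition edge_rel : rel T := fun x y => (x != y) && ([set x; y] \in E).

Lemma edge_rel_sym : symmetric edge_rel.
Proof. by move=> x y; rewrite /edge_rel eq_sym finset.setUC. Qed.

Lemma edge_rel_irr : irreflexive edge_rel.
Proof. by move=> x; rewrite /edge_rel eqxx. Qed.

Definition graph_of_edges : sgraph T := SGraph edge_rel_sym edge_rel_irr.

End EdgeSet.

Local Open Scope ring_scope.

Definition vpairs (n : nat) : {set {set 'I_n}} := [set e : {set 'I_n} | #|e| == 2%N].

(* Probability of the event [A] under G(n,p), summed over all edge sets; the
   weights are nonnegative only when 0 <= p <= 1. *)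
Definition gnp_prob (R : realType) (n : nat) (p : R) (A : pred (sgraph 'I_n)) : R :=
  \sum_(E in powerset (vpairs n) | A (graph_of_edges E))
     \prod_(e in vpairs n) (if e \in E then p else 1 - p).

Definition aas (R : realType) (p : nat -> R)
    (A : forall n, pred (sgraph 'I_n)) : Prop :=
  ((fun n => gnp_prob (p n) (A n)) @ \oo --> (1 : R))%classic.

(* Main.v *)
From Pilot Require Import Defs.
From mathcomp Require Import all_boot all_order all_algebra.
From mathcomp Require Import all_classical all_reals all_analysis.
From mathcomp Require Import zify ring lra.
From mathcomp Require Import fintype finset bigop.
Set Implicit Arguments.
Unset Strict Implicit.
Unset Printing Implicit Defensive.
Import Order.TTheory GRing.Theory Num.Theory.
Import numFieldNormedType.Exports.
Import Pilot.Defs.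

(* Write x = np, which tends to infinity, and L = log x. Three first-moment
   estimates show that a.a.s.
   - every set of size at most m ~ n / L^2 spans few edges, hence is
     O(x / L^2)-colorable;
   - any two disjoint sets of size at least a ~ n / x^(1/4) are joined by an edge;
   - there is no independent set of size q ~ 4 L / p, so chi(G) >= x / (5 L).
   The second property makes all small sets outside an exceptional set expand by
   a factor x^(1/4), so some vertex v reaches all but a vertices within distance
   D + 1, where D = O(log n / L). Given a proper coloring c, the unreached
   vertices need only O(x / L^2) colors, so the reached ones carry at least
   chi(G) - O(x / L^2) colors of c. Join one representative of each of (at most
   chi(G)) such colors to v by a shortest path. The resulting connected set has
   O(x log n / L) vertices, which is at most m because p log^2 n < 1; thus its
   chromatic number is O(x / L^2) = O(chi(G) / L). *)

(** * Proper colorings and degeneracy *)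

Section Deterministic.
Local Open Scope nat_scope.
Variables (T : finType) (G : sgraph T).
Implicit Types (S X Y Z : {set T}).

Lemma proper_coloringP (K : eqType) (U : finType) (H : sgraph U) (c : U -> K) :
  reflect (forall x y, adj H x y -> c x != c y) (proper_coloring H c).
Proof.
apply: (iffP idP) => [/forallP cP x y xy|cP].
  by move/(_ x)/forallP/(_ y)/implyP/(_ xy) : cP.
by apply/forallP => x; apply/forallP => y; apply/implyP; exact: cP.
Qed.

Lemma chi_le (U : finType) (H : sgraph U) k : colorable H k -> chi H <= k.
Proof. by rewrite /chi; case: ex_minnP => j _; apply. Qed.

Lemma chi_le_coloring (U K : finType) (H : sgraph U) (c : U -> K) :
  proper_coloring H c -> chi H <= #|K|.
Proof.
move=> /proper_coloringP cP; apply: chi_le; apply/existsP.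
exists [ffun x => enum_rank (c x)]; apply/proper_coloringP => x y /cP.
by rewrite !ffunE; apply: contra_neq => /enum_rank_inj.
Qed.

Lemma chi_colorable (U : finType) (H : sgraph U) : colorable H (chi H).
Proof. by rewrite /chi; case: ex_minnP. Qed.

(** A total map on [T] gives colorings of nested sets one common type, so a coloring of [S] minus a
    vertex extends to [S] without transport. *)
Definition colors_on k (c : T -> 'I_k) S : Prop :=
  {in S &, forall x y, adj G x y -> c x != c y}.

Lemma chi_induced_colors_on k (c : T -> 'I_k) S :
  colors_on c S -> chi (induced G S) <= k.
Proof.
move=> cS; rewrite -[k in _ <= k]card_ord.
apply: (@chi_le_coloring _ _ _ (c \o val)); apply/proper_coloringP => x y xy /=.
by apply: cS => //; exact: valP.
Qed.

(** Greedy coloring: remove a vertex with fewer than [d] neighbors in [S], color the rest, then give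
    it a color absent from those neighbors. Positivity of [d] provides the default color for the
    empty set. *)
Lemma degenerate_colors_on m d :
  (forall S, S != finset.set0 -> #|S| <= m ->
     exists2 x, x \in S & #|[set y in S | adj G x y]| < d) ->
  forall S, 0 < d -> #|S| <= m -> exists c : T -> 'I_d, colors_on c S.
Proof.
move=> deg S d0; have [s] : exists s, #|S| <= s by exists #|S|.
elim: s S => [|s IHs] S Ss Sm.
  exists (fun=> Ordinal d0) => x y.
  by move: Ss; rewrite leqn0 cards_eq0 => /eqP ->; rewrite inE.
have [S0|S0] := eqVneq S finset.set0.
  by exists (fun=> Ordinal d0) => x y; rewrite S0 inE.
have [x xS xd] := deg S S0 Sm.
have := cardsD1 x S; rewrite xS add1n => cS.
have [||c cP] := IHs (S :\ x); [lia|lia|].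
pose N := [set y in S | adj G x y].
have [i iN] : exists i, i \in ~: (c @: N).
  apply/set0Pn; rewrite -card_gt0; have := cardsC (c @: N); rewrite card_ord.
  have := leq_imset_card c N; move: xd; rewrite -/N; lia.
exists (fun y => if y == x then i else c y) => y z yS zS yz.
have iP u : u \in S -> adj G x u -> i != c u.
  move=> uS xu; move: iN; rewrite inE; apply: contraNneq => ->.
  by apply: imset_f; rewrite inE uS.
have [yx|yx] := eqVneq y x; have [zx|zx] := eqVneq z x.
- by move: yz; rewrite yx zx adj_irr.
- by apply: iP => //; rewrite -yx.
- by rewrite eq_sym; apply: iP => //; rewrite -zx adj_sym.
- by apply: cP; rewrite // !inE ?yx ?zx.
Qed.

(** * Neighborhoods, expansion and balls *)

Definition cnbhd S : {set T} := [set y | (y \in S) || [exists x in S, adj G x y]].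

Lemma cnbhdU S Y : cnbhd (S :|: Y) = cnbhd S :|: cnbhd Y.
Proof.
apply/setP => y; rewrite !inE; apply/idP/idP.
  case/orP => [/orP[]->|/existsP[x /andP[]]]; rewrite ?orbT // inE.
  case/orP => xS xy; apply/orP; [left|right]; apply/orP; right;
    by apply/existsP; exists x; rewrite xS.
by case/orP => /orP[->|/existsP[x /andP[xS xy]]]; rewrite ?orbT //;
  apply/orP; right; apply/existsP; exists x; rewrite inE xS ?orbT.
Qed.

Lemma sub_cnbhd S : S \subset cnbhd S.
Proof. by apply/subsetP => x xS; rewrite inE xS. Qed.

Lemma cnbhdS S Y : S \subset Y -> cnbhd S \subset cnbhd Y.
Proof. by move=> /setUidPr <-; rewrite cnbhdU subsetUl. Qed.

Definition bipartite_hole_free a : Prop := forall S Y,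
  [disjoint S & Y] -> a <= #|S| -> a <= #|Y| ->
  exists x y, [/\ x \in S, y \in Y & adj G x y].

(** No edge joins [S] to the complement of its closed neighborhood, so two such sets of size at
    least [a] would form a hole. *)
Lemma hole_free_cnbhd a S : bipartite_hole_free a ->
  a <= #|S| -> #|~: cnbhd S| < a.
Proof.
move=> free aS; rewrite ltnNge; apply/negP => aC.
have [|x [y [xS + xy]]] := free S (~: cnbhd S) _ aS aC.
  by rewrite -subsets_disjoint sub_cnbhd.
by rewrite !inE negb_or => /andP[_ /existsP[]]; exists x; rewrite xS.
Qed.

Definition graph_ball v j : {set T} := iter j cnbhd [set v].

(* Outside a maximal non-expanding set [X] every small set expands. *)
Lemma large_ball a l D : 0 < l -> bipartite_hole_free a -> 0 < a ->
  (2 * l + 1) * a <= #|T| -> a < l ^ D -> exists v, #|~: graph_ball v D.+1| < a.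
Proof.
move=> l0 free a0 aT aD.
pose P X := (#|X| <= a) && (#|cnbhd X| <= l * #|X|).
have cn0 : cnbhd finset.set0 = finset.set0.
  apply/setP => y; rewrite !inE /=; apply/negbTE/negP => /existsP[x].
  by rewrite inE.
have P0 : P finset.set0 by rewrite /P cn0 cards0.
case: (arg_maxnP (fun X : {set T} => #|X|) P0) => X /andP[Xa XN] Xmax.
have expand Y : Y != finset.set0 -> [disjoint Y & X] -> #|Y| <= a ->
    l * #|Y| < #|cnbhd Y :\: X|.
  move=> Y0 YX Ya; rewrite ltnNge; apply/negP => YN.
  have cXY : #|X :|: Y| = #|X| + #|Y|.
    by rewrite cardsU setIC; move: YX; rewrite -setI_eq0 => /eqP->; rewrite cards0 subn0.
  have Y1 : 0 < #|Y| by rewrite card_gt0.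
  (* If [Y] failed to expand, the union with [X] would fail too; when that union has at most [a]
     elements, this contradicts the maximality of [X]. *)
  have NXY : #|cnbhd (X :|: Y)| <= l * #|X :|: Y|.
    rewrite cnbhdU cXY.
    have sub : cnbhd X :|: cnbhd Y \subset cnbhd X :|: (cnbhd Y :\: X).
      apply/subsetP => z; rewrite in_setU => /orP[zX|zY]; first by rewrite in_setU zX.
      rewrite in_setU in_setD zY andbT; case: (boolP (z \in X)) => zX; rewrite ?orbT //.
      by rewrite (subsetP (sub_cnbhd X)).
    have := subset_leq_card sub; have := cardsU (cnbhd X) (cnbhd Y :\: X).
    move: XN YN; rewrite mulnDr; lia.
  have [XYa|aXY] := leqP #|X :|: Y| a.
    by have := Xmax (X :|: Y); rewrite /P XYa NXY /= => /(_ isT); rewrite /=; lia.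
  (* Here the union has between [a] and [2 * a] elements: its neighborhood has at most [2 * l * a]
     vertices yet misses fewer than [a], against the lower bound on [#|T|]. *)
  have := hole_free_cnbhd free (ltnW aXY).
  have := cardsC (cnbhd (X :|: Y)); move: NXY aT Xa Ya; rewrite cXY; nia.
have [v vX] : exists v, v \notin X.
  apply/existsP; apply: contraTT aT => /existsPn Xall.
  have : #|T| <= #|X| by rewrite -cardsT; apply: subset_leq_card; apply/subsetP => x _;
    rewrite -[x \in X]negbK.
  rewrite -ltnNge; nia.
exists v.
(* Balls around [v] with [X] deleted at each step, so that [expand] applies to all of them; they
   grow by a factor [l] until their size exceeds [a]. *)
pose B j := iter j (fun Y => cnbhd Y :\: X) [set v].
have Bball j : B j \subset graph_ball v j.
  elim: j => //= j IHj; apply: subset_trans (cnbhdS IHj); exact: subsetDl.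
have BX j : [disjoint B j & X].
  case: j => [|j] /=; first by rewrite disjoints1.
  by rewrite -setI_eq0 setDE -setIA [~: X :&: X]setIC setICr setI0.
have BS j : B j \subset B j.+1.
  by rewrite /= subsetD sub_cnbhd BX.
have Bcard j : a < #|B j| \/ l ^ j <= #|B j|.
  elim: j => [|j [aB|IHj]]; first by right; rewrite cards1.
    by left; apply: leq_trans aB (subset_leq_card (BS j)).
  have [Ba|aB] := leqP #|B j| a; last by left; apply: leq_trans aB (subset_leq_card (BS j)).
  right; apply: ltnW; rewrite expnS; apply: leq_ltn_trans (expand _ _ (BX j) Ba).
    by rewrite leq_mul2l IHj orbT.
  by rewrite -card_gt0; apply: leq_trans IHj; rewrite expn_gt0 l0.
(* The ball of radius [D] has at least [a] vertices; the absence of holes turns this into the claim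
   for radius [D.+1]. *)
apply: hole_free_cnbhd free _.
apply: leq_trans (subset_leq_card (Bball D)).
by case: (Bcard D) => [/ltnW//|]; apply: leq_trans; exact: ltnW.
Qed.

(** * Rooted connected sets *)

Definition connected_from v S : Prop := v \in S /\
  forall x, x \in S -> exists p, [/\ path (adj G) v p, {subset p <= S} & x = last v p].

(** Any two vertices are joined through the root. The rooted form is used because it passes at once
    to unions with a common root. *)
Lemma connected_from_induced v S :
  connected_from v S -> graph_connected (induced G S).
Proof.
case=> vS conn; pose v' : {x : T | x \in S} := exist _ v vS.
apply/andP; split; first by apply/card_gt0P; exists v'.
have csym : connect_sym (adj (induced G S)).
  by apply: sym_connect_sym; exact: adj_sym.
have from_v x : connect (adj (induced G S)) v' x.
  case: x => x xS; have [p [vp pS xp]] := conn x xS.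
  (* The path is lifted to the subtype vertex by vertex, so its starting point has to vary in the
     induction. *)
  suff gen q (w : {x : T | x \in S}) : {subset q <= S} -> path (adj G) (val w) q ->
      x = last (val w) q -> connect (adj (induced G S)) w (exist _ x xS).
    exact: (gen p v').
  elim: q w => [|y q IHq] w qS /=.
    by move=> _ xw; rewrite (_ : exist _ _ _ = w) //; exact: val_inj.
  case/andP => wy yq xq.
  have yS : y \in S by apply: qS; rewrite mem_head.
  apply: (@connect_trans _ _ (exist _ y yS)); first exact: connect1.
  by apply: IHq => // z zq; apply: qS; rewrite in_cons zq orbT.
apply/forallP => x; apply/forallP => y.
by apply: (connect_trans _ (from_v y)); rewrite csym.
Qed.

(** The set consists of the vertices of a walk of length at most [j] from [v] to [w]. *)
Lemma ball_connected_from v j w : w \in graph_ball v j ->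
  exists S, [/\ connected_from v S, w \in S & #|S| <= j.+1].
Proof.
elim: j w => [|j IHj] w.
  rewrite /graph_ball /= inE => /eqP ->; exists [set v]; rewrite cards1 inE; split => //.
  by split; rewrite ?inE // => x; rewrite inE => /eqP ->; exists [::].
rewrite /graph_ball iterS inE => /orP[/IHj[S [vS wS cS]]|/existsP[u /andP[/IHj[S [[vS conn] uS cS]] uw]]].
  by exists S; split => //; exact: leqW.
exists (w |: S); split; rewrite ?setU11 //; last by rewrite cardsU1; lia.
split; first by rewrite inE vS orbT.
move=> x; rewrite in_setU1 => /orP[/eqP ->|xS].
  have [p [vp pS up]] := conn u uS; exists (rcons p w).
  rewrite rcons_path vp -up uw last_rcons; split => // z.
  by rewrite mem_rcons in_cons in_setU1 => /orP[->//|/pS ->]; rewrite orbT.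
have [p [vp pS xp]] := conn x xS; exists p; split => // z /pS.
by rewrite in_setU1 => ->; rewrite orbT.
Qed.

(** Union of the walks from [v] to the elements of [s]; the summand 1 accounts for the root when [s]
    is empty. *)
Lemma connected_from_cover v j (s : seq T) : {subset s <= graph_ball v j} ->
  exists S, [/\ connected_from v S, {subset s <= S} & #|S| <= 1 + size s * j.+1].
Proof.
elim: s => [|w s IHs] sB.
  have [|S [? ? ?]] := @ball_connected_from v 0 v; first by rewrite /graph_ball inE.
  by exists S.
have [|S [[vS conn] sS cS]] := IHs.
  by move=> x xs; apply: sB; rewrite in_cons xs orbT.
have [S' [[vS' conn'] wS' cS']] := ball_connected_from (sB w (mem_head _ _)).
exists (S' :|: S); split.
- split; first by rewrite inE vS orbT.
  move=> x; rewrite in_setU => /orP[/conn'|/conn] [p [vp pS xp]]; exists p; split => // z /pS;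
    by rewrite in_setU => ->; rewrite ?orbT.
- by move=> x; rewrite in_cons => /orP[/eqP ->|/sS xS]; rewrite inE ?wS' ?xS ?orbT.
- by rewrite /= mulSn; have := cardsU S' S; lia.
Qed.

(** * Colors on a set and the lower bound for [phihat] *)

Lemma mem_colors (c : T -> nat) S x : x \in S -> c x \in undup [seq c x | x in S].
Proof. by move=> xS; rewrite mem_undup; apply: map_f; rewrite mem_enum. Qed.

(** The colors of [c] on [Z], together with a disjoint palette for the complement, color [G]
    properly. *)
Lemma chi_le_ncolors (c : T -> nat) Z k :
  proper_coloring G c -> chi (induced G (~: Z)) <= k -> chi G <= ncolors c Z + k.
Proof.
move=> /proper_coloringP cP chiZ; apply: leq_trans (leq_add (leqnn _) chiZ).
have /existsP [d /proper_coloringP dP] := chi_colorable (induced G (~: Z)).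
have idx x (xZ : x \in Z) : index (c x) (undup [seq c x | x in Z]) < ncolors c Z.
  by rewrite index_mem mem_colors.
have cZ x : x \notin Z -> x \in ~: Z by rewrite inE.
pose f x : 'I_(ncolors c Z) + 'I_(chi (induced G (~: Z))) :=
  match boolP (x \in Z) with
  | AltTrue xZ => inl (Ordinal (idx x xZ))
  | AltFalse xZ => inr (d (exist _ x (cZ x xZ)))
  end.
rewrite -[X in X + _]card_ord -[X in _ + X]card_ord -card_sum.
apply: (@chi_le_coloring _ _ _ f); apply/proper_coloringP => x y xy; rewrite /f.
case: {-}_ / boolP => xZ; case: {-}_ / boolP => yZ //.
- apply: contraNneq (cP x y xy) => -[] e.
  by apply/eqP; rewrite -(nth_index 0 (mem_colors c xZ)) e nth_index // mem_colors.
- by apply: contraNneq (dP (exist _ x (cZ x xZ)) (exist _ y (cZ y yZ)) xy) => -[] ->.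
Qed.

Lemma colors_representatives (c : T -> nat) Z r : r <= ncolors c Z ->
  exists s, [/\ {subset s <= Z}, size s = r & uniq (map c s)].
Proof.
move=> rZ.
have lift (u : seq nat) : {subset u <= [seq c x | x in Z]} ->
    exists s, {subset s <= Z} /\ map c s = u.
  elim: u => [|j u IHu] uZ; first by exists [::].
  have [|s [sZ cs]] := IHu; first by move=> i iu; apply: uZ; rewrite in_cons iu orbT.
  have /imageP[x xZ jx] := uZ j (mem_head _ _).
  exists (x :: s); rewrite /= -jx cs; split => // y.
  by rewrite in_cons => /orP[/eqP ->|/sZ].
have [|s [sZ cs]] := lift (take r (undup [seq c x | x in Z])).
  by move=> i /mem_take; rewrite mem_undup.
exists s; split; rewrite // ?cs ?take_uniq ?undup_uniq //.
by rewrite -(size_map c) cs size_takel.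
Qed.

Lemma ncolors_ge (c : T -> nat) S s :
  {subset s <= S} -> uniq (map c s) -> size s <= ncolors c S.
Proof.
move=> sS us; rewrite -(size_map c); apply: uniq_leq_size => // i.
by case/mapP => x /sS xS ->; exact: mem_colors.
Qed.

(** One [K] pays for the vertices outside the ball, the other for the chromatic number of the
    connected set through the representatives. *)
Lemma chi_le_phihat_col (c : T -> nat) a l D K m :
  0 < a <= m -> 0 < l -> (2 * l + 1) * a <= #|T| -> a < l ^ D ->
  bipartite_hole_free a ->
  (forall S, #|S| <= m -> chi (induced G S) <= K) ->
  1 + chi G * D.+2 <= m -> proper_coloring G c -> chi G <= phihat_col G c + 2 * K.
Proof.
move=> /andP[a0 am] l0 aT aD free small mchi cP.
have [v vZ] := large_ball l0 free a0 aT aD.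
set Z := graph_ball v D.+1 in vZ.
have chiZ := chi_le_ncolors cP (small _ (leq_trans (ltnW vZ) am)).
(* Capping the representatives at [chi G] bounds the connected set whatever the number of colors of
   [c]. Each one costs at most [D.+2] vertices, as the ball has radius [D.+1]. *)
have [s [sZ ss us]] := colors_representatives (geq_minr (chi G) (ncolors c Z)).
have [S [/connected_from_induced conn sS cS]] := connected_from_cover sZ.
have chiS : chi (induced G S) <= K.
  apply: small; apply: leq_trans mchi; apply: leq_trans cS _.
  by rewrite leq_add2l ss leq_mul2r geq_minl orbT.
have : ncolors c S - chi (induced G S) <= phihat_col G c.
  exact: (leq_bigmax_cond (F := fun S => ncolors c S - chi (induced G S))).
have := ncolors_ge sS us; rewrite ss /=; lia.
Qed.

Lemma chi_le_phihat a l D K m :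
  0 < a <= m -> 0 < l -> (2 * l + 1) * a <= #|T| -> a < l ^ D ->
  bipartite_hole_free a ->
  (forall S, #|S| <= m -> chi (induced G S) <= K) ->
  1 + chi G * D.+2 <= m -> chi G <= phihat G + 2 * K.
Proof.
move=> am l0 aT aD free small mchi; rewrite /phihat /min_col.
case: ex_minnP => i /asboolP[c cP <-] _.
exact: chi_le_phihat_col am l0 aT aD free small mchi cP.
Qed.

Lemma phihat_le_phi : phihat G <= phi G.
Proof.
rewrite /phi /phihat /min_col; case: ex_minnP => j _ jmin.
case: ex_minnP => i /asboolP[c cP <-] _; apply: (@leq_trans (phihat_col G c)).
  by apply: jmin; apply/asboolP; exists c.
apply/bigmax_leqP => S _.
exact: (leq_bigmax_cond (P := predT) (F := fun S => ncolors c S - chi (induced G S))).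
Qed.

(** * Bounds on the chromatic number *)

Definition edge_pairs S : {set T * T} :=
  [set e | [&& e.1 \in S, e.2 \in S & adj G e.1 e.2]].

(** Ordered pairs are counted, so [#|edge_pairs S|] is the degree sum of the induced graph. Average
    degree below [k] yields a vertex of degree below [k], and degeneracy applies. *)
Lemma sparse_chi m k : 0 < k ->
  (forall S, S != finset.set0 -> #|S| <= m -> #|edge_pairs S| < k * #|S|) ->
  forall S, #|S| <= m -> chi (induced G S) <= k.
Proof.
move=> k0 sparse S Sm.
have [|c] := degenerate_colors_on _ k0 Sm; last exact: chi_induced_colors_on.
move=> Y Y0 Ym; apply/exists_inP; apply: contraLR (sparse Y Y0 Ym).
move=> /exists_inPn deg; rewrite -leqNgt.
have -> : #|edge_pairs Y| = \sum_(x in Y) #|[set y in Y | adj G x y]|.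
  rewrite -sum1_card (eq_bigr (fun x => \sum_(y in [set y in Y | adj G x y]) 1)).
    by rewrite pair_big_dep /=; apply: eq_bigl => -[x y]; rewrite !inE.
  by move=> x _; rewrite sum1_card.
rewrite mulnC -sum_nat_const; apply: leq_sum => x /deg.
by rewrite -leqNgt.
Qed.

(** Color classes are independent, hence have at most [q] vertices each. *)
Lemma card_le_chi q : (forall S, #|S| = q -> exists x y, [/\ x \in S, y \in S & adj G x y]) ->
  #|T| <= chi G * q.
Proof.
move=> indep; have /existsP[c /proper_coloringP cP] := chi_colorable G.
rewrite -{1}(card_ord (chi G)) -sum_nat_const -sum1_card.
rewrite (partition_big c predT) //=; apply: leq_sum => i _.
rewrite sum1_card leqNgt; apply/negP => qi.
(* The hypothesis concerns sets of exactly [q] vertices, so a [q]-subset is extracted from the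
   oversized class. *)
have : 0 < #|[set S : {set T} | (S \subset [set x | c x == i]) & #|S| == q]|.
  by rewrite cards_draws bin_gt0 cardsE ltnW.
case/card_gt0P => S; rewrite inE => /andP[/subsetP Si /eqP /indep[x [y [xS yS xy]]]].
have := cP x y xy; have := Si x xS; have := Si y yS.
by rewrite !inE => /eqP -> /eqP ->; rewrite eqxx.
Qed.

(** Cut the vertices, by rank, into blocks of at most [m] vertices and color the blocks with
    disjoint palettes of size [K]. This a priori bound on [chi G] keeps the connected set small. *)
Lemma chi_le_blocks K m : 0 < m ->
  (forall S, #|S| <= m -> chi (induced G S) <= K) -> chi G <= K * (#|T| %/ m).+1.
Proof.
move=> m0 small.
pose b (x : T) := enum_rank x %/ m.
have bT x : b x < (#|T| %/ m).+1.
  by rewrite ltnS leq_div2r // ltnW.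
pose blk j : {set T} := [set x | b x == j].
have blkm j : #|blk j| <= m.
  pose f (x : T) : 'I_m := Ordinal (ltn_pmod (enum_rank x) m0).
  rewrite -[m]card_ord -(card_in_imset (f := f)) ?max_card // => x y.
  rewrite !inE => /eqP bx /eqP byj [] e; apply: enum_rank_inj; apply: val_inj.
  by rewrite /= (divn_eq (enum_rank x) m) (divn_eq (enum_rank y) m) e -/(b x) bx -byj.
have ex j : exists d : {x : T | x \in blk j} -> 'I_K, proper_coloring (induced G (blk j)) d.
  have /existsP [d /proper_coloringP dP] := chi_colorable (induced G (blk j)).
  exists (widen_ord (small _ (blkm j)) \o d); apply/proper_coloringP => x y /dP /=.
  by apply: contra_neq => /(congr1 val) /= /val_inj.
pose d j := projT1 (cid (ex j)); pose dP j := projT2 (cid (ex j)).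
have inb x : x \in blk (b x) by rewrite inE.
pose f x : 'I_K * 'I_(#|T| %/ m).+1 := (d (b x) (exist _ x (inb x)), Ordinal (bT x)).
rewrite -[K]card_ord -[X in _ * X]card_ord -card_prod.
apply: (@chi_le_coloring _ _ _ f); apply/proper_coloringP => x y xy.
rewrite xpair_eqE negb_and /f /= orbC; case: eqVneq => //= -[].
move: (inb x) (inb y) => + + bxy; rewrite -bxy => xb yb.
by move/proper_coloringP: (dP (b x)) => /(_ (exist _ x xb) (exist _ y yb) xy).
Qed.

End Deterministic.

Local Open Scope ring_scope.

(** * Elementary real inequalities *)

Section RealBounds.
Variable R : realType.

Lemma exp_const_le4 : expR 1 <= 4 :> R.
Proof.
(* Squaring and inverting $e^{-1/2} \ge 1/2$ gives $e \le 4$. *)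
have h := expR_ge1Dx (- 2^-1 : R).
have e1 : expR (1:R) = (expR (- 2^-1) ^+ 2)^-1.
  by rewrite -expRM_natl -expRN; congr expR; field.
rewrite e1 -[X in _ <= X]invrK lef_pV2 ?posrE ?exprn_gt0 ?expR_gt0 //.
have : (2^-1) ^+ 2 <= expR (- 2^-1 : R) ^+ 2 by rewrite lerXn2r ?nnegrE ?expR_ge0 //; lra.
lra.
Qed.

(** Induction on [t]; the inductive step rests on $(1 + 1/t)^t \le e$. *)
Lemma pow_le_fact (t : nat) : t%:R ^+ t <= expR 1 ^+ t * t`!%:R :> R.
Proof.
elim: t => [|t IHt]; first by rewrite !expr0 mul1r.
case: t IHt => [_|t IHt].
  by rewrite !expr1 mulr1; have := expR_ge1Dx (1:R); lra.
have t0 : 0 < t.+1%:R :> R by [].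
have step : t.+2%:R ^+ t.+1 <= expR 1 * t.+1%:R ^+ t.+1 :> R.
  rewrite -ler_pdivrMr ?exprn_gt0 // -expr_div_n.
  have -> : t.+2%:R / t.+1%:R = 1 + t.+1%:R^-1 :> R.
    by rewrite -[t.+2%:R]natr1 mulrDl divff ?mul1r // lt0r_neq0.
  have -> : expR (1:R) = expR t.+1%:R^-1 ^+ t.+1.
    by rewrite -expRM_natl divff // lt0r_neq0.
  by rewrite lerXn2r ?nnegrE ?expR_ge0 ?expR_ge1Dx // addr_ge0 // invr_ge0 ltW.
rewrite exprS factS natrM.
have e0 := expR_gt0 (1:R).
apply: le_trans (ler_wpM2l _ step) _ => //.
rewrite [expR 1 ^+ t.+2]exprS.
have h : 0 <= t.+2%:R * expR 1 :> R by rewrite mulr_ge0 // ltW.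
have := ler_wpM2l h IHt; rewrite -!mulrA; lra.
Qed.

(** From $\binom{N}{t} \le N^t / t!$ and $t^t \le e^t\, t!$, with $e$ replaced by 4. *)
Lemma bin_le_pow (N t : nat) : (0 < t)%N -> 'C(N, t)%:R <= (4 * N%:R / t%:R) ^+ t :> R.
Proof.
move=> t0; have tr : 0 < t%:R :> R by rewrite ltr0n.
rewrite expr_div_n ler_pdivlMr ?exprn_gt0 //.
apply: le_trans (ler_wpM2l _ (pow_le_fact t)) _ => //.
rewrite [in X in _ <= X]exprMn mulrCA -natrM bin_ffact.
apply: ler_pM; rewrite ?ler0n ?exprn_ge0 ?expR_ge0 //.
  by rewrite lerXn2r ?nnegrE ?expR_ge0 ?exp_const_le4.
rewrite -natrX ler_nat; elim: t {t0 tr} N => // t IHt N.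
rewrite ffactnS expnS leq_mul // (leq_trans (IHt _)) //.
by case: t {IHt} => // t; rewrite leq_exp2r // leq_pred.
Qed.

Lemma one_addM_exp (x : R) N : 0 <= 1 + x -> (1 + x) ^+ N <= expR (N%:R * x).
Proof.
by move=> x0; rewrite expRM_natl lerXn2r ?nnegrE ?expR_ge0 ?expR_ge1Dx.
Qed.

Lemma bin2_le_sq t : 'C(t, 2)%:R <= t%:R ^+ 2 / 2 :> R.
Proof.
rewrite ler_pdivlMr // -natrX -natrM ler_nat mulnC mul2n.
by rewrite bin2; have := odd_double_half (t * t.-1); case: t => // t /=; nia.
Qed.

Lemma sum_geometric_le (r : R) N : 0 <= r <= 2^-1 ->
  \sum_(i < N) r ^+ i.+1 <= 2 * r.
Proof.
(* The factor $1 - r^N$ strengthens the bound enough for induction on [N]. *)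
move=> /andP[r0 r2]; suff : \sum_(i < N) r ^+ i.+1 <= 2 * r * (1 - r ^+ N).
  move=> /le_trans; apply; rewrite -[X in _ <= X]mulr1 ler_wpM2l ?mulr_ge0 //.
  by rewrite gerBl exprn_ge0.
elim: N => [|N IHN]; first by rewrite big_ord0 expr0 subrr mulr0.
rewrite big_ord_recr /=.
have h : 0 <= r ^+ N.+1 by rewrite exprn_ge0.
have := ler_wpM2l h r2; rewrite !exprS in h *; lra.
Qed.

End RealBounds.

(** * Basic tools for $G(n,p)$ *)

Section Gnp.
Variables (R : realType) (n : nat) (p : R).
Implicit Types (E F : {set {set 'I_n}}) (A B C : pred (sgraph 'I_n)) (S Y : {set 'I_n}).

Definition edge_weight E : R := \prod_(e in vpairs n) (if e \in E then p else 1 - p).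

(* Evaluated at [y = 0] this is the probability of avoiding [F]; at [y >= 1] it
   yields the Chernoff bound for the number of edges in [F]. *)
Lemma edge_weight_genfun F y : F \subset vpairs n ->
  \sum_(E in powerset (vpairs n)) edge_weight E * y ^+ #|E :&: F| =
  (1 - p + p * y) ^+ #|F|.
Proof.
move=> /subsetP FV.
have powE (D : {set {set 'I_n}}) (z : R) : z ^+ #|D| = \prod_e (if e \in D then z else 1).
  by rewrite -big_mkcond prodr_const.
(* [f] weighs a present pair and [g] an absent one. Outside [vpairs n] they are 0 and 1, so that
   expanding the product of [f e + g e] leaves only subsets of [vpairs n]. *)
pose f e := if e \in vpairs n then (if e \in F then p * y else p) else 0.
pose g e := if e \in vpairs n then 1 - p else 1.
have -> : (1 - p + p * y) ^+ #|F| = \prod_e (f e + g e).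
  rewrite powE; apply: eq_bigr => e _; rewrite /f /g.
  have := FV e; case: (e \in F) => [/(_ isT) ->|_]; first by rewrite addrC.
  by case: ifP => _; ring.
rewrite bigA_distr [RHS](bigID (mem (powerset (vpairs n)))) /=.
rewrite [X in _ = _ + X]big1 ?addr0; last first.
  move=> E; rewrite powersetE => /subsetPn[e eE eV].
  by rewrite (bigD1 e) //= eE /f (negbTE eV) mul0r.
apply: eq_bigr => E; rewrite powersetE => /subsetP EV.
rewrite powE /edge_weight big_mkcond -big_split; apply: eq_bigr => e _ /=.
rewrite in_setI /f /g; have := EV e; case: (e \in E) => [/(_ isT) ->|_] /=.
  by case: ifP => _; rewrite ?mulr1.
by case: ifP => _; rewrite mulr1.
Qed.

Hypothesis p01 : 0 <= p <= 1.

Lemma edge_weight_ge0 E : 0 <= edge_weight E.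
Proof.
by have /andP[p0 p1] := p01; apply: prodr_ge0 => e _; case: ifP; rewrite ?subr_ge0.
Qed.

(** The total mass is 1: this is the generating function of the empty [F]. *)
Lemma gnp_prob_compl A : gnp_prob p A = 1 - gnp_prob p (predC A).
Proof.
have := edge_weight_genfun 1 (sub0set (vpairs n)); rewrite cards0 expr0.
under eq_bigr do rewrite expr1n mulr1.
rewrite (bigID (fun E => A (graph_of_edges E))) /= => <-.
by rewrite /gnp_prob addrK.
Qed.

Lemma gnp_prob_ge0 A : 0 <= gnp_prob p A.
Proof. by apply: sumr_ge0 => E _; exact: edge_weight_ge0. Qed.

Lemma gnp_prob_union (I : finType) (P : pred I) A (B : I -> pred (sgraph 'I_n)) :
  (forall G, A G -> exists2 i, P i & B i G) ->
  gnp_prob p A <= \sum_(i | P i) gnp_prob p (B i).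
Proof.
move=> AB; rewrite /gnp_prob.
under [X in _ <= X]eq_bigr do rewrite big_mkcondr.
rewrite exchange_big /= big_mkcondr; apply: ler_sum => E _.
have w0 := edge_weight_ge0 E.
case: ifP => [/AB[i Pi BiE]|_]; last first.
  by apply: sumr_ge0 => i _; case: ifP.
rewrite (bigD1 i) //= BiE lerDl.
by apply: sumr_ge0 => j _; case: ifP.
Qed.

Lemma gnp_prob_orb C A B : (forall G, C G -> A G || B G) ->
  gnp_prob p C <= gnp_prob p A + gnp_prob p B.
Proof.
move=> CAB; have : forall G, C G -> exists2 b : bool, predT b & (if b then A else B) G.
  by move=> G /CAB /orP[AG|BG]; [exists true|exists false].
by move=> /gnp_prob_union; rewrite big_bool.
Qed.

(** Markov's inequality for the random variable $c\, y^{|E \cap F|}$. *)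
Lemma gnp_prob_le_genfun A F y c : F \subset vpairs n -> 0 <= y -> 0 <= c ->
  (forall E, E \subset vpairs n -> A (graph_of_edges E) -> 1 <= c * y ^+ #|E :&: F|) ->
  gnp_prob p A <= c * (1 - p + p * y) ^+ #|F|.
Proof.
move=> FV y0 c0 AE; rewrite -edge_weight_genfun // mulr_sumr /gnp_prob big_mkcondr.
apply: ler_sum => E; rewrite powersetE => EV; rewrite -/(edge_weight E).
have w0 := edge_weight_ge0 E.
case: ifP => [/(AE E EV) h|_]; last by rewrite !mulr_ge0 // exprn_ge0.
by rewrite mulrCA -{1}[edge_weight E]mulr1 ler_wpM2l.
Qed.

(** * First-moment estimates for the three bad events *)

Definition inner_pairs S : {set {set 'I_n}} := [set e : {set 'I_n} | (e \subset S) && (#|e| == 2%N)].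

Lemma inner_pairs_sub S : inner_pairs S \subset vpairs n.
Proof. by apply/subsetP => e; rewrite !inE => /andP[]. Qed.

Lemma card_inner_pairs S : #|inner_pairs S| = 'C(#|S|, 2).
Proof. exact: cards_draws. Qed.

(* Both orientations of an edge [e] are among the four elements of [e * e]. *)
Lemma card_edge_pairs_le E S :
  (#|edge_pairs (graph_of_edges E) S| <= 4 * #|E :&: inner_pairs S|)%N.
Proof.
rewrite -sum1_card (partition_big (fun e => [set e.1; e.2]) (mem (E :&: inner_pairs S))) /=.
  rewrite mulnC -sum_nat_const; apply: leq_sum => e; rewrite !inE => /and3P[_ _ /eqP e2].
  rewrite sum1_card (_ : 4 = #|setX e e|)%N; last by rewrite cardsX e2.
  apply: subset_leq_card; apply/subsetP => -[x y].
  by rewrite !inE => /andP[_ /eqP <-] /=; rewrite !inE !eqxx orbT.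
move=> [x y]; rewrite !inE /= /edge_rel => /and3P[xS yS /andP[xy ->]].
by rewrite cards2 xy subUset !sub1set xS yS.
Qed.

(** Markov's inequality with $c = y^{-k|S|}$; the factor 4 in the event matches the one in
    [card_edge_pairs_le]. *)
Lemma dense_prob S k y : 1 <= y ->
  gnp_prob p (fun G => 4 * k * #|S| <= #|edge_pairs G S|)%N <=
  y ^- (k * #|S|) * (1 - p + p * y) ^+ 'C(#|S|, 2).
Proof.
move=> y1; have y0 : 0 < y by lra.
rewrite -card_inner_pairs; apply: gnp_prob_le_genfun; rewrite ?inner_pairs_sub ?ltW //.
  by rewrite invr_gt0 exprn_gt0.
move=> E EV h; have {h} kE : (k * #|S| <= #|E :&: inner_pairs S|)%N.
  by have := leq_trans h (card_edge_pairs_le E S); rewrite -mulnA leq_pmul2l.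
by rewrite mulrC ler_pdivlMr ?exprn_gt0 // mul1r ler_weXn2l.
Qed.

Lemma cross_free_prob S Y : [disjoint S & Y] ->
  gnp_prob p (fun G => [forall x in S, forall y in Y, ~~ adj G x y]) <=
  (1 - p) ^+ (#|S| * #|Y|).
Proof.
move=> dSY.
pose F := [set [set e.1; e.2] | e in setX S Y].
have dxy x y : x \in S -> y \in Y -> x != y.
  by move=> xS yY; apply: contraTneq yY => <-; rewrite (disjointFr dSY xS).
have FV : F \subset vpairs n.
  apply/subsetP => _ /imsetP[[x y] + ->]; rewrite !inE /= => /andP[xS yY].
  by rewrite cards2 dxy.
have cF : #|F| = (#|S| * #|Y|)%N.
  rewrite card_in_imset ?cardsX // => -[x y] [x' y']; rewrite !inE /=.
  move=> /andP[xS yY] /andP[xS' yY'] e.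
  have : x \in [set x'; y'] by rewrite -e !inE eqxx.
  have : y \in [set x'; y'] by rewrite -e !inE eqxx orbT.
  rewrite !inE; have := dxy _ _ xS yY'; rewrite eq_sym; have := dxy _ _ xS' yY.
  by rewrite [x' == y]eq_sym [y' == x]eq_sym => /negbTE -> /negbTE -> /= /eqP -> /orP[/eqP->|].
(* At $y = 0$ the variable $y^{|E \cap F|}$ is the indicator of avoiding [F], since $0^0 = 1$. *)
rewrite -cF; have -> : 1 - p = 1 - p + p * 0 by ring.
rewrite -[X in _ <= X]mul1r; apply: gnp_prob_le_genfun => // E EV none.
suff -> : E :&: F = finset.set0 by rewrite cards0 expr0 mulr1.
apply/setP => e; rewrite !inE; apply/negP => /andP[eE /imsetP[[x y]]].
rewrite inE /= => /andP[xS yY] ee.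
move/forall_inP/(_ x xS)/forall_inP/(_ y yY)/negP : none; apply.
by rewrite /= /edge_rel dxy // -ee.
Qed.

Lemma independent_prob S :
  gnp_prob p (fun G => [forall x in S, forall y in S, ~~ adj G x y]) <=
  (1 - p) ^+ 'C(#|S|, 2).
Proof.
rewrite -card_inner_pairs; have -> : 1 - p = 1 - p + p * 0 by ring.
rewrite -[X in _ <= X]mul1r; apply: gnp_prob_le_genfun => //.
  exact: inner_pairs_sub.
move=> E EV none.
suff -> : E :&: inner_pairs S = finset.set0 by rewrite cards0 expr0 mulr1.
apply/setP => e; rewrite !inE; apply/negP => /and3P[eE + /cards2P[x [y [xy ee]]]].
rewrite ee subUset !sub1set => /andP[xS yS].
move/forall_inP/(_ x xS)/forall_inP/(_ y yS)/negP : none; apply.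
by rewrite /= /edge_rel xy -ee.
Qed.

(** Union bound over the [t]-sets: each contributes at most $(t/(m_0 2^k))^t$, and $\binom{n}{t} \le
    (4n/t)^t$ cancels the $t$. *)
Lemma dense_prob_size (k t : nat) (m0 : R) : 0 < p -> (0 < k)%N -> (0 < t)%N ->
  t%:R <= m0 -> 8 * p * m0 <= k%:R ->
  gnp_prob p (fun G => [exists S : {set 'I_n},
    (#|S| == t) && (4 * k * #|S| <= #|edge_pairs G S|)%N]) <=
  (4 * n%:R / m0 / 2 ^+ k) ^+ t.
Proof.
move=> p0 k0 t0 tm pk.
have tr : 0 < t%:R :> R by rewrite ltr0n.
have kr : 0 < k%:R :> R by rewrite ltr0n.
have m0r : 0 < m0 by lra.
have ptr : 0 < p * t%:R by rewrite mulr_gt0.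
(* With this $y$ one has $t^2 p y = tk$, so the moment factor is at most $e^{tk}$. *)
have [y yE] : exists y, y = k%:R / (p * t%:R) by exists (k%:R / (p * t%:R)).
have y1 : 1 <= y by rewrite yE ler_pdivlMr // mul1r; nra.
have yk : y ^- k * expR k%:R <= t%:R / m0 / 2 ^+ k.
  have -> : expR k%:R = expR 1 ^+ k :> R by rewrite -expRM_natl mulr1.
  rewrite -exprVn -exprMn.
  apply: (@le_trans _ _ ((t%:R / m0 / 2) ^+ k)).
    rewrite lerXn2r ?nnegrE ?mulr_ge0 ?invr_ge0 ?expR_ge0 //; try lra.
    have -> : y^-1 * expR 1 = t%:R / m0 / 2 * (2 * expR 1 * (p * m0) / k%:R).
      by rewrite yE; field; rewrite !lt0r_neq0.
    rewrite ler_piMr ?divr_ge0 ?(ltW m0r) // ler_pdivrMr // mul1r.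
    have := ler_wpM2r (ltW (mulr_gt0 p0 m0r)) (exp_const_le4 R); lra.
  (* Of the [k] factors $t/m_0 \le 1$ one is kept, to cancel against the binomial coefficient; the
     others are bounded by 1. *)
  rewrite expr_div_n ler_wpM2r ?invr_ge0 ?exprn_ge0 //.
  rewrite -(prednK k0) exprS ler_piMr ?divr_ge0 ?(ltW m0r) //.
  by rewrite exprn_ile1 ?divr_ge0 ?(ltW m0r) // ler_pdivrMr // mul1r.
have bound S : #|S| = t -> gnp_prob p (fun G => (4 * k * #|S| <= #|edge_pairs G S|)%N)
    <= (t%:R / m0 / 2 ^+ k) ^+ t.
  move=> St; apply: le_trans (dense_prob S k y1) _; rewrite St.
  have -> : 1 - p + p * y = 1 + p * (y - 1) by ring.
  apply: le_trans (ler_wpM2l _ (one_addM_exp _ _)) _.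
  - by rewrite invr_ge0 exprn_ge0 //; lra.
  - by rewrite addr_ge0 // mulr_ge0 //; lra.
  apply: (@le_trans _ _ ((y ^- k * expR k%:R) ^+ t)); last first.
    by rewrite lerXn2r ?nnegrE ?mulr_ge0 ?invr_ge0 ?expR_ge0 ?exprn_ge0 //; lra.
  rewrite exprMn exprVn -exprM ler_wpM2l ?invr_ge0 ?exprn_ge0 //; try lra.
  rewrite -expRM_natl ler_expR.
  have -> : t%:R * k%:R = t%:R ^+ 2 * (p * y).
    by rewrite yE; field; rewrite !lt0r_neq0.
  apply: ler_pM => //; first by rewrite mulr_ge0 //; lra.
    by apply: le_trans (bin2_le_sq R t) _; rewrite ler_pdivrMr // ler_peMr ?exprn_ge0 //; lra.
  by rewrite ler_wpM2l ?ltW //; lra.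
apply: le_trans (gnp_prob_union (P := fun S => #|S| == t) _) _.
  by move=> G /existsP[S /andP[St SG]]; exists S; [exact: St|exact: SG].
apply: (@le_trans _ _ (\sum_(S : {set 'I_n} | #|S| == t) (t%:R / m0 / 2 ^+ k) ^+ t)).
  by apply: ler_sum => S /eqP; exact: bound.
rewrite sumr_const (_ : #|_| = 'C(n, t)); last first.
  by rewrite -[n in RHS]card_ord -card_draws cardsE.
rewrite -[_ *+ 'C(_, _)]mulr_natl; apply: le_trans (ler_wpM2r _ (bin_le_pow R n t0)) _.
  by rewrite exprn_ge0 ?divr_ge0 ?exprn_ge0 //; lra.
rewrite -exprMn mulrA mulrA divfK ?lt0r_neq0 //.
Qed.

(** The bounds for the sizes [1] to [m] are powers of one ratio at most $1/2$, so their sum is at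
    most twice the ratio. *)
Lemma locally_dense_prob (m k : nat) (m0 : R) : 0 < p -> (0 < k)%N ->
  m%:R <= m0 -> 0 < m0 -> 8 * p * m0 <= k%:R -> 4 * n%:R / m0 / 2 ^+ k <= 2^-1 ->
  gnp_prob p (fun G => [exists S : {set 'I_n}, [&& S != finset.set0, (#|S| <= m)%N &
    (4 * k * #|S| <= #|edge_pairs G S|)%N]]) <= 2 * (4 * n%:R / m0 / 2 ^+ k).
Proof.
move=> p0 k0 mm m0r pk r2.
have r0 : 0 <= 4 * n%:R / m0 / 2 ^+ k by rewrite !divr_ge0 ?mulr_ge0 ?exprn_ge0 // ltW.
apply: le_trans (sum_geometric_le m (_ : 0 <= _ <= _)); last by rewrite r0 r2.
apply: le_trans (gnp_prob_union (I := 'I_m) (P := predT) (B := fun i G =>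
    [exists S : {set 'I_n}, (#|S| == i.+1) && (4 * k * #|S| <= #|edge_pairs G S|)%N]) _) _.
  move=> G /existsP[S /and3P[]]; rewrite -card_gt0 => S0 Sm SG.
  have Si : (#|S|.-1 < m)%N by rewrite prednK.
  by exists (Ordinal Si) => //; apply/existsP; exists S; rewrite /= prednK ?eqxx.
apply: ler_sum => i _; apply: dense_prob_size => //.
by apply: le_trans mm; rewrite ler_nat.
Qed.

(** Union bound over all $4^n$ pairs of vertex sets, each term being at most $(1-p)^{a^2}$. *)
Lemma hole_prob (a : nat) :
  gnp_prob p (fun G => [exists S : {set 'I_n}, exists Y : {set 'I_n},
    [&& [disjoint S & Y], (a <= #|S|)%N, (a <= #|Y|)%N &
      [forall x in S, forall y in Y, ~~ adj G x y]]]) <=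
  4 ^+ n * expR (- (p * a%:R ^+ 2)).
Proof.
have /andP[p0 p1] := p01.
pose P (SY : {set 'I_n} * {set 'I_n}) :=
  [&& [disjoint SY.1 & SY.2], (a <= #|SY.1|)%N & (a <= #|SY.2|)%N].
apply: le_trans (gnp_prob_union (P := P) (B := fun SY G =>
    [forall x in SY.1, forall y in SY.2, ~~ adj G x y]) _) _.
  by move=> G /existsP[S /existsP[Y /and4P[dSY aS aY SY]]]; exists (S, Y); rewrite /P //= dSY aS.
apply: (@le_trans _ _ (\sum_(SY : {set 'I_n} * {set 'I_n}) expR (- (p * a%:R ^+ 2)))).
  rewrite big_mkcond; apply: ler_sum => -[S Y] _; case: ifP => [/and3P[/= dSY aS aY]|_].
    apply: le_trans (cross_free_prob dSY) _.
    apply: (@le_trans _ _ ((1 - p) ^+ (a * a))).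
      by apply: ler_wiXn2l; rewrite ?leq_mul // ?subr_ge0 // gerBl.
    apply: le_trans (one_addM_exp _ _) _; rewrite ?subr_ge0 // ler_expR natrM.
    by rewrite expr2; lra.
  exact: expR_ge0.
have cS : #|{: {set 'I_n}}| = (2 ^ n)%N.
  by rewrite -cardsT -powersetT card_powerset cardsT card_ord.
rewrite sumr_const card_prod /= cS -[expR _ *+ _]mulr_natl natrM !natrX.
rewrite -exprMn (_ : 2 * 2 = 4) //; ring.
Qed.

(** Since $\binom{q}{2} = q(q-1)/2$, the probability for one set is at most a [q]-th power, which
    merges with $\binom{n}{q} \le (4n/q)^q$. *)
Lemma independent_set_prob (q : nat) : (0 < q)%N ->
  gnp_prob p (fun G => [exists S : {set 'I_n}, (#|S| == q) &&
    [forall x in S, forall y in S, ~~ adj G x y]]) <=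
  (4 * n%:R / q%:R * expR (- (p * q.-1%:R / 2))) ^+ q.
Proof.
move=> q0; have /andP[p0 p1] := p01.
apply: le_trans (gnp_prob_union (P := fun S => #|S| == q) (B := fun S G =>
    [forall x in S, forall y in S, ~~ adj G x y]) _) _.
  by move=> G /existsP[S /andP[Sq SG]]; exists S.
apply: (@le_trans _ _ (\sum_(S : {set 'I_n} | #|S| == q) (1 - p) ^+ 'C(q, 2))).
  by apply: ler_sum => S /eqP <-; exact: independent_prob.
rewrite sumr_const (_ : #|_| = 'C(n, q)); last first.
  by rewrite -[n in RHS]card_ord -card_draws cardsE.
rewrite -[_ *+ 'C(_, _)]mulr_natl exprMn; apply: ler_pM; rewrite ?exprn_ge0 ?subr_ge0 //.
  exact: bin_le_pow.
apply: le_trans (one_addM_exp _ _) _; rewrite ?subr_ge0 // -expRM_natl ler_expR.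
have -> : 'C(q, 2)%:R = q%:R * q.-1%:R / 2 :> R.
  rewrite -natrM (_ : q * q.-1 = 'C(q, 2) * 2)%N ?natrM ?mulfK //.
  by rewrite -[RHS]/('C(q, 2) * 2`!)%N bin_ffact ffactnS ffactn1.
lra.
Qed.

End Gnp.


(** * Choice of the numerical parameters *)

Lemma pow5_le_expR (R : realType) (L : R) : 10 ^+ 9 <= L -> L ^+ 5 <= expR (L / 8).
Proof.
move=> L9; have L0 : 0 <= L by lra.
have h := expR_ge1Dxn 5 (divr_ge0 L0 (ler0n R 8)).
(* The term of degree 6 suffices because $8^6 \cdot 6! < 10^9 \le L$. *)
apply: le_trans (h); rewrite expr_div_n exprS (_ : 6`!%:R = 720 :> R) //.
have : 0 <= L ^+ 5 by rewrite exprn_ge0.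
nra.
Qed.

Lemma pow_gap (R : realType) (L : R) (i j : nat) :
  10 ^+ 9 <= L -> (i < j)%N -> 10 ^+ 9 * L ^+ i <= L ^+ j.
Proof.
move=> L9 ij; have L1 : 1 <= L by lra.
apply: (@le_trans _ _ (L ^+ i.+1)); last exact: ler_weXn2l.
by rewrite [L ^+ i.+1]exprS ler_wpM2r // exprn_ge0 //; lra.
Qed.

(** With $u = x^{1/8}$, take $l = \lfloor u^2 \rfloor$ and for [a] the largest value with
    [(2 * l + 1) * a <= n]. As $l \ge u \ge 10^9 L^2$, the bound on $a L^2$ follows. *)
Lemma expansion_parameters (R : realType) (n : nat) (L u : R) :
  10 ^+ 9 <= L -> u = expR (L / 8) -> u ^+ 8 <= n%:R -> L <= ln n%:R ->
  exists a l D : nat, [/\ [/\ (0 < a)%N, (0 < l)%N, ((2 * l + 1) * a <= n)%N & (a < l ^ D)%N],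
    n%:R / (4 * u ^+ 2) <= a%:R, a%:R * L ^+ 2 <= n%:R & D.+2%:R <= 11 * (ln n%:R / L)].
Proof.
move=> L9 uE un LN.
have L0 : 0 < L by lra.
have uL : 10 ^+ 9 * L ^+ 2 <= u.
  rewrite uE; apply: le_trans (pow5_le_expR L9); exact: pow_gap.
have L2 : 1 <= L ^+ 2 by rewrite exprn_ege1 //; lra.
have u9 : 10 ^+ 9 <= u by lra.
have u0 : 0 < u by lra.
have u20 : 0 < u ^+ 2 by rewrite exprn_gt0.
have u2 : 10 ^+ 9 * u <= u ^+ 2 by rewrite -{1}[u]expr1; exact: pow_gap.
have n0 : 0 < n%:R :> R by apply: lt_le_trans un; rewrite exprn_gt0.
have [l lE] : exists l, l = Num.truncn (u ^+ 2) by exists (Num.truncn (u ^+ 2)).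
have /andP[l1 l2] : l%:R <= u ^+ 2 < l.+1%:R by rewrite lE truncn_itv // ltW.
have lu : u <= l%:R by move: l2; rewrite -natr1 => l2; clear -l2 u9 u2 u0; lra.
have l0 : (0 < l)%N by rewrite -(ltr_nat R); exact: lt_le_trans lu.
have lr : (2 * l + 1)%:R = 2 * l%:R + 1 :> R by rewrite natrD natrM.
have [a aE] : exists a, a = (n %/ (2 * l + 1))%N by exists (n %/ (2 * l + 1))%N.
have al : ((2 * l + 1) * a <= n)%N by rewrite aE mulnC leq_trunc_div.
have a1 : n%:R / (4 * u ^+ 2) <= a%:R.
  have : (n < (2 * l + 1) * a.+1)%N.
    by rewrite aE mulnC; apply: ltn_ceil; rewrite addn1.
  rewrite -(ltr_nat R) natrM lr -natr1 => h.
  have : u ^+ 4 <= n%:R by apply: le_trans un; apply: ler_weXn2l => //; lra.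
  have u4 : u ^+ 4 = u ^+ 2 * u ^+ 2 by rewrite -exprD.
  rewrite ler_pdivrMr ?mulr_gt0 // u4 => u4n.
  have a0 : 0 <= a%:R :> R by [].
  clear -h u4n l1 a0 u2 u9; nra.
have a2 : a%:R * L ^+ 2 <= n%:R.
  move: al; rewrite -(ler_nat R) natrM lr; apply: le_trans.
  by rewrite mulrC ler_wpM2r //; clear -uL lu u0 L2; lra.
have a0 : (0 < a)%N.
  by rewrite -(ltr_nat R); apply: lt_le_trans a1; rewrite divr_gt0 // mulr_gt0.
have NL0 : 0 <= 8 * ln n%:R / L.
  by rewrite divr_ge0 ?mulr_ge0 ?(ltW L0) // (le_trans _ LN) // ltW.
have NL : 1 <= ln n%:R / L by rewrite ler_pdivlMr // mul1r.
(* The witness is [D.+1]: it exceeds $8 \log n / L$, so $u^{D+1} > n \ge a$. The offset 3 in [D.+3]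
   is absorbed by $\log n / L \ge 1$, whence the 11. *)
have [D DE] : exists D, D = Num.truncn (8 * ln n%:R / L) by exists (Num.truncn (8 * ln n%:R / L)).
have /andP[D1 D2] : D%:R <= 8 * ln n%:R / L < D.+1%:R by rewrite DE truncn_itv.
exists a, l, D.+1; split => //; first split => //.
- rewrite -(ltr_nat R) natrX; apply: (@le_lt_trans _ _ n%:R).
    by rewrite ler_nat aE leq_div.
  apply: (@lt_le_trans _ _ (u ^+ D.+1)); last first.
    by rewrite lerXn2r // nnegrE ?ler0n // ltW.
  rewrite uE -expRM_natl -[X in X < _]lnK ?posrE // ltr_expR.
  move: D2; rewrite ltr_pdivrMr // => D2; clear -D2; lra.
- rewrite -(addn3 D) natrD; move: D1; rewrite -mulrA => D1; clear -D1 NL; lra.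
Qed.

(** Here $p a^2 \ge n u^4 / 16 \ge 3n$, which beats $4^n \le e^{2n}$ and leaves $e^{-n} \le 1/L$. *)
Lemma hole_bound (R : realType) (n a : nat) (p u L : R) :
  10 ^+ 9 <= u -> n%:R * p = u ^+ 8 -> u ^+ 8 <= n%:R -> 0 < p -> 0 < L <= u ->
  n%:R / (4 * u ^+ 2) <= a%:R -> 4 ^+ n * expR (- (p * a%:R ^+ 2)) <= L^-1.
Proof.
move=> u9 xu un p0 /andP[L0 Lu] a1.
have u0 : 0 < u by lra.
have n0 : 0 < n%:R :> R by apply: lt_le_trans un; rewrite exprn_gt0.
have h : n%:R * 3 <= p * a%:R ^+ 2.
  apply: (@le_trans _ _ (p * (n%:R / (4 * u ^+ 2)) ^+ 2)); last first.
    rewrite ler_wpM2l ?(ltW p0) // lerXn2r ?nnegrE //.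
    by rewrite divr_ge0 ?mulr_ge0 ?exprn_ge0 ?(ltW u0).
  have -> : p * (n%:R / (4 * u ^+ 2)) ^+ 2 = n%:R * (n%:R * p / (16 * u ^+ 4)).
    by field; rewrite lt0r_neq0.
  rewrite xu ler_wpM2l // (_ : u ^+ 8 / (16 * u ^+ 4) = u ^+ 4 / 16).
    have := pow_gap u9 (isT : (0 < 4)%N); rewrite expr0; clear; lra.
  by field; rewrite lt0r_neq0.
apply: (@le_trans _ _ (expR (- n%:R))).
  have e2 : 4 <= expR 2 :> R.
    have -> : 2 = 2%:R * 1 :> R by rewrite mulr1.
    rewrite expRM_natl; have := expR_ge1Dx (1:R); clear; nra.
  apply: (@le_trans _ _ (expR 2 ^+ n * expR (- (p * a%:R ^+ 2)))).
    by rewrite ler_wpM2r ?expR_ge0 // lerXn2r // nnegrE ?expR_ge0.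
  rewrite -expRM_natl -expRD ler_expR; clear -h; lra.
rewrite expRN lef_pV2 ?posrE ?expR_gt0 //.
apply: le_trans (expR_ge1Dx _); apply: le_trans Lu _.
apply: (@le_trans _ _ n%:R); last by rewrite lerDr.
by apply: le_trans un; rewrite -{1}[u]expr1; apply: ler_weXn2l => //; clear -u9; lra.
Qed.

(** Take $m_0 = 10^4 n / L^2$ with integer part [m], and for [k] the first integer above $8 p m_0 =
    8 \cdot 10^4 x / L^2$. *)
Lemma density_parameters (R : realType) (n : nat) (p L x : R) :
  10 ^+ 9 <= L -> x = n%:R * p -> L ^+ 5 <= x -> x <= n%:R -> 0 < p ->
  exists (m k : nat) (m0 : R), [/\
    [/\ 0 < m0, m%:R <= m0, 8 * p * m0 <= k%:R & 4 * n%:R / m0 / 2 ^+ k <= (2 * L)^-1],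
    (0 < k)%N, 5 * 10 ^+ 3 * (n%:R / L ^+ 2) <= m%:R,
    (8 * k)%:R <= 8 * 10 ^+ 5 * (x / L ^+ 2) &
    (4 * k * (n %/ m).+1)%:R <= 108 * x].
Proof.
move=> L9 xE xL5 xn p0.
have L0 : 0 < L by lra.
have L20 : 0 < L ^+ 2 by rewrite exprn_gt0.
have xL : 10 ^+ 9 * L ^+ 2 <= x by apply: le_trans xL5; exact: pow_gap.
have L2 : 10 ^+ 9 <= L ^+ 2 by have := pow_gap L9 (isT : (0 < 2)%N); rewrite expr0 mulr1.
have L3 : L ^+ 3 <= x.
  by apply: le_trans xL5; apply: ler_weXn2l => //; clear -L9; lra.
have x0 : 0 < x by apply: lt_le_trans xL; rewrite mulr_gt0.
have n0 : 0 < n%:R :> R by exact: lt_le_trans xn.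
have [w wE] : exists w, w = n%:R / L ^+ 2 by exists (n%:R / L ^+ 2).
have nw : n%:R = w * L ^+ 2 by rewrite wE divfK // lt0r_neq0.
have w9 : 10 ^+ 9 <= w by rewrite wE ler_pdivlMr //; exact: le_trans xn.
have [z zE] : exists z, z = x / L ^+ 2 by exists (x / L ^+ 2).
have xz : x = z * L ^+ 2 by rewrite zE divfK // lt0r_neq0.
have z9 : 10 ^+ 9 <= z by rewrite zE ler_pdivlMr.
have pwz : p * w = z by rewrite wE zE xE; ring.
have w0 : 0 < w by clear -w9; lra.
have z0 : 0 < z by clear -z9; lra.
have m00 : 0 < 10 ^+ 4 * w by rewrite mulr_gt0 ?exprn_gt0.
have [m mE] : exists m, m = Num.truncn (10 ^+ 4 * w) by exists (Num.truncn (10 ^+ 4 * w)).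
have /andP[m1 m2] : m%:R <= 10 ^+ 4 * w < m.+1%:R by rewrite mE truncn_itv // ltW.
have m3 : 5 * 10 ^+ 3 * w <= m%:R.
  by move: m2; rewrite -natr1 => m2; clear -m2 w9; lra.
have k00 : 0 <= 8 * 10 ^+ 4 * z by rewrite !mulr_ge0 ?exprn_ge0 // ltW.
have [k kE] : exists k, k = Num.truncn (8 * 10 ^+ 4 * z) by exists (Num.truncn (8 * 10 ^+ 4 * z)).
have /andP[k1 k2] : k%:R <= 8 * 10 ^+ 4 * z < k.+1%:R by rewrite kE truncn_itv.
have k3 : k.+1%:R <= 9 * 10 ^+ 4 * z.
  by rewrite -natr1; clear -k1 z9; lra.
have kr : 0 < k.+1%:R :> R by [].
exists m, k.+1, (10 ^+ 4 * w); rewrite -wE -zE; split; first split => //.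
- have -> : 8 * p * (10 ^+ 4 * w) = 8 * 10 ^+ 4 * z by rewrite -pwz; ring.
  exact: ltW.
(* Since $n / m_0$ is only of order $L^2$, the crude $2^k \ge k \ge x / L^2 \ge L^3$ is enough. *)
- apply: (@le_trans _ _ (4 * n%:R / (10 ^+ 4 * w) / k.+1%:R)).
    apply: ler_wpM2l; first by rewrite divr_ge0 ?mulr_ge0 // ltW.
    by rewrite lef_pV2 ?posrE ?exprn_gt0 // -natrX ler_nat ltnW // ltn_expl.
  have -> : 4 * n%:R / (10 ^+ 4 * w) = 4 * L ^+ 2 / 10 ^+ 4.
    by rewrite nw; field; rewrite lt0r_neq0.
  rewrite ler_pdivrMr // [X in _ <= X]mulrC ler_pdivlMr ?mulr_gt0 //.
  apply: (@le_trans _ _ (L ^+ 3)).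
    have -> : 4 * L ^+ 2 / 10 ^+ 4 * (2 * L) = 8 / 10 ^+ 4 * L ^+ 3 by field.
    have : 0 <= L ^+ 3 by rewrite exprn_ge0 // ltW.
    clear; lra.
  have zk : z <= k.+1%:R by clear -k2 z0; lra.
  apply: le_trans zk; rewrite -(ler_pM2r L20) -xz -exprD; exact: xL5.
- by [].
- exact: m3.
- rewrite natrM; clear -k3 z9; lra.
rewrite !natrM.
have B3 : (n %/ m).+1%:R <= 3 / 10 ^+ 4 * L ^+ 2 :> R.
  have : (n %/ m * m <= n)%N by rewrite leq_trunc_div.
  rewrite -(ler_nat R) natrM => h.
  have : (n %/ m)%:R * (5 * 10 ^+ 3 * w) <= w * L ^+ 2.
    by rewrite -nw; apply: le_trans h; rewrite ler_wpM2l ?ler0n ?m3.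
  rewrite -[(n %/ m).+1%:R]natr1; move: ((n %/ m)%:R) => b.
  have -> : b * (5 * 10 ^+ 3 * w) = w * (5 * 10 ^+ 3 * b) by ring.
  by rewrite ler_pM2l // => b5; clear -b5 L2; lra.
have -> : 108 * x = 4 * (9 * 10 ^+ 4 * z) * (3 / 10 ^+ 4 * L ^+ 2).
  by rewrite xz; field.
by apply: ler_pM; rewrite ?mulr_ge0 ?ler0n // ler_wpM2l.
Qed.

Lemma independence_parameter (R : realType) (n : nat) (p L x : R) :
  10 ^+ 9 <= L -> x = n%:R * p -> x = expR L -> 0 < p <= 1 ->
  exists q : nat, [/\ (0 < q)%N,
    x / (5 * L) <= n%:R / q%:R &
    (4 * n%:R / q%:R * expR (- (p * q.-1%:R / 2))) ^+ q <= L^-1].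
Proof.
move=> L9 xE xL /andP[p0 p1].
have L0 : 0 < L by lra.
have Lx : L <= x by rewrite xL; apply: le_trans (expR_ge1Dx L); rewrite lerDr.
have x0 : 0 < x by exact: lt_le_trans Lx.
have Lp0 : 0 < 4 * L / p by rewrite divr_gt0 // mulr_gt0.
(* The witness is [q.+2], so that its predecessor still exceeds $4L/p$; the exponential is then at
   most $x^{-2}$, while $4n/(q+2) \le x$. *)
have [q qE] : exists q, q = Num.truncn (4 * L / p) by exists (Num.truncn (4 * L / p)).
have /andP[q1 q2] : q%:R <= 4 * L / p < q.+1%:R by rewrite qE truncn_itv // ltW.
have Lp : L <= L / p by rewrite ler_pdivlMr // ler_piMr // ltW.
have q3 : q.+2%:R <= 5 * (L / p).
  move: q1; rewrite -(addn2 q) natrD -mulrA => q1; clear -q1 Lp L9; lra.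
have qr : 0 < q.+2%:R :> R by [].
exists q.+2; split => //.
  rewrite ler_pdivlMr // mulrAC ler_pdivrMr ?mulr_gt0 //.
  apply: le_trans (ler_wpM2l (ltW x0) q3) _.
  by rewrite xE (_ : _ * p * _ = n%:R * (5 * L)) //; field; rewrite lt0r_neq0.
have qe : 4 * n%:R / q.+2%:R * expR (- (p * q.+1%:R / 2)) <= x^-1.
  have q4 : 4 * n%:R / q.+2%:R <= x.
    rewrite ler_pdivrMr //.
    apply: (@le_trans _ _ (x * (4 * L / p))); last first.
      apply: ler_wpM2l; first exact: ltW.
      by apply: le_trans (ltW q2) _; rewrite ler_nat.
    rewrite xE (_ : _ * p * _ = 4 * n%:R * L); last by field; rewrite lt0r_neq0.
    by rewrite ler_peMr ?mulr_ge0 //; clear -L9; lra.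
  have qL : expR (- (p * q.+1%:R / 2)) <= (x ^+ 2)^-1.
    have -> : (x ^+ 2)^-1 = expR (- (2 * L)) by rewrite expRN expRM_natl xL.
    rewrite ler_expR lerN2; move: q2; rewrite ltr_pdivrMr // => q2; clear -q2; lra.
  have -> : x^-1 = x * (x ^+ 2)^-1 by field; rewrite lt0r_neq0.
  by apply: ler_pM => //; rewrite ?expR_ge0 ?divr_ge0 ?mulr_ge0.
have xV : x^-1 <= L^-1 by rewrite lef_pV2 ?posrE.
have xV1 : x^-1 <= 1 by rewrite invf_le1 //; clear -Lx L9; lra.
apply: le_trans (le_trans qe xV).
by rewrite exprS ler_piMr ?exprn_ile1 ?(le_trans qe xV1) // mulr_ge0 ?expR_ge0 ?divr_ge0 ?mulr_ge0.
Qed.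

Lemma parameters (R : realType) (n : nat) (p : R) (L := ln (n%:R * p)) :
  0 < p <= 1 -> p * ln n%:R ^+ 2 <= 1 -> 10 ^+ 9 <= L ->
  exists a l D m k q : nat, exists m0 : R, [/\
    [/\ (0 < a <= m)%N, (0 < l)%N, ((2 * l + 1) * a <= n)%N & (a < l ^ D)%N],
    (0 < k)%N /\ (1 + 4 * k * (n %/ m).+1 * D.+2 <= m)%N,
    (0 < q)%N /\ (8 * k)%:R <= 4 * 10 ^+ 6 * (n%:R / q%:R) / L,
    [/\ 0 < m0, m%:R <= m0, 8 * p * m0 <= k%:R & 4 * n%:R / m0 / 2 ^+ k <= (2 * L)^-1] &
    4 ^+ n * expR (- (p * a%:R ^+ 2)) <= L^-1 /\
    (4 * n%:R / q%:R * expR (- (p * q.-1%:R / 2))) ^+ q <= L^-1].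
Proof.
move=> p01 pn L9; have /andP[p0 p1] := p01.
have L0 : 0 < L by lra.
have [x xE] : exists x, x = n%:R * p by exists (n%:R * p).
have x0 : 0 < x.
  by rewrite ltNge; apply/negP => x0; move: L0; rewrite /L -xE ln0 // ltxx.
have n0 : 0 < n%:R :> R by move: x0; rewrite xE pmulr_lgt0.
have xn : x <= n%:R by rewrite xE ler_piMr // ltW.
have LN : L <= ln n%:R by rewrite /L -xE ler_ln ?posrE.
have xL : x = expR L by rewrite /L -xE lnK.
have [u uE] : exists u, u = expR (L / 8) by exists (expR (L / 8)).
have xu : x = u ^+ 8 by rewrite uE -expRM_natl xL; congr expR; field.
have uL : L ^+ 5 <= u by rewrite uE; exact: pow5_le_expR.
have Lu : L <= u by apply: le_trans uL; rewrite -{1}[L]expr1 ler_weXn2l //; lra.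
have u9 : 10 ^+ 9 <= u by exact: le_trans Lu.
have ux : u <= x by rewrite xu -{1}[u]expr1 ler_weXn2l //; lra.
have [|a [l [D [[a0 l0 al aD] a1 a2 D3]]]] := expansion_parameters L9 uE _ LN.
  by rewrite -xu.
have [m [k [m0 [Hm k0 m3 k8 km]]]] := density_parameters L9 xE (le_trans uL ux) xn p0.
have [q [q0 qx Hq]] := independence_parameter L9 xE xL p01.
have L20 : 0 < L ^+ 2 by rewrite exprn_gt0.
exists a, l, D, m, k, q, m0; split => //.
- split => //; rewrite a0 -(ler_nat R); apply: le_trans m3.
  move: a2; rewrite -ler_pdivlMr // => a2; apply: le_trans a2 _.
  have : 0 <= n%:R / L ^+ 2 by rewrite divr_ge0 // ltW.
  by clear; lra.
- split => //; rewrite -(ler_nat R) natrD natrM; apply: le_trans m3.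
  (* The upper bound on [p] enters here: $p L \log n \le p \log^2 n \le 1$. The walks then need at
     most $1 + 108 \cdot 11\, n / L^2$ vertices, below $5 \cdot 10^3\, n / L^2 \le m$. *)
  have xN : x * (ln n%:R / L) <= n%:R / L ^+ 2.
    rewrite xE ler_pdivlMr //.
    have -> : n%:R * p * (ln n%:R / L) * L ^+ 2 = n%:R * (p * (ln n%:R * L)).
      by field; rewrite lt0r_neq0.
    rewrite ler_piMr // (le_trans _ pn) // expr2.
    by rewrite !ler_wpM2l // ?(ltW p0) // (le_trans _ LN) // ltW.
  have h1 : 1 <= x * (ln n%:R / L).
    apply: mulr_ege1; first by apply: le_trans (le_trans u9 ux); clear; lra.
    by rewrite ler_pdivlMr // mul1r.
  have h2 := ler_pM (ler0n _ _) (ler0n _ _) km D3.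
  by clear -xN h1 h2; lra.
- split => //; apply: le_trans k8 _.
  (* The constant $4 \cdot 10^6$ is 5 times $8 \cdot 10^5$, the 5 coming from $n/q \ge x/(5L)$. *)
  rewrite (_ : _ * _ = 4 * 10 ^+ 6 * (x / (5 * L)) / L).
    by rewrite ler_wpM2r ?invr_ge0 ?(ltW L0) // ler_wpM2l // mulr_ge0 ?exprn_ge0.
  by field; rewrite lt0r_neq0.
- split => //; apply: (hole_bound u9 _ _ p0 _ a1); first by rewrite -xE.
    by rewrite -xu.
  by rewrite L0 Lu.
Qed.


(** * Combining the estimates, and the limit *)

Lemma gnp_phihat_ge (R : realType) (n : nat) (p : R) (L := ln (n%:R * p)) :
  0 < p <= 1 -> p * ln n%:R ^+ 2 <= 1 -> 10 ^+ 9 <= L ->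
  1 - 3 / L <= gnp_prob p (fun G : sgraph 'I_n => (phihat G <= phi G)%N &&
    ((chi G)%:R * (1 - 4 * 10 ^+ 6 / L) <= (phihat G)%:R)).
Proof.
move=> /andP[p0 p1] pn L9; have p01 : 0 <= p <= 1 by rewrite ltW.
have L0 : 0 < L by apply: lt_le_trans L9; rewrite exprn_gt0.
have [a [l [D [m [k [q [m0 [H1 [k0 Hm] [q0 Hq] [m00 mm0 pm r2] [Hhole Hindep]]]]]]]]] :=
  parameters (introT andP (conj p0 p1)) pn L9.
rewrite -/L in Hq r2 Hhole Hindep; case: H1 => am l0 al aD.
have r21 : 4 * n%:R / m0 / 2 ^+ k <= 2^-1.
  by apply: le_trans r2 _; rewrite lef_pV2 ?posrE ?mulr_gt0 // ler_peMr //; lra.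
rewrite gnp_prob_compl // lerD2l lerN2.
pose dense (G : sgraph 'I_n) := [exists S : {set 'I_n}, [&& S != finset.set0,
  (#|S| <= m)%N & (4 * k * #|S| <= #|edge_pairs G S|)%N]].
pose hole (G : sgraph 'I_n) := [exists S : {set 'I_n}, exists Y : {set 'I_n},
  [&& [disjoint S & Y], (a <= #|S|)%N, (a <= #|Y|)%N &
    [forall x in S, forall y in Y, ~~ adj G x y]]].
pose indep (G : sgraph 'I_n) := [exists S : {set 'I_n}, (#|S| == q) &&
  [forall x in S, forall y in S, ~~ adj G x y]].
(* Each of the three bad events receives probability at most $1/L$; the first is written as in
   [locally_dense_prob]. *)
have -> : 3 / L = 2 * (2 * L)^-1 + (L^-1 + L^-1) by field; rewrite lt0r_neq0.
have dense_le : gnp_prob p dense <= 2 * (2 * L)^-1.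
  by apply: le_trans (locally_dense_prob p01 p0 k0 mm0 m00 pm r21) _; rewrite ler_wpM2l.
have hole_le : gnp_prob p hole <= L^-1 by apply: le_trans (hole_prob n p01 a) Hhole.
have indep_le : gnp_prob p indep <= L^-1.
  by apply: le_trans (independent_set_prob n p01 q0) Hindep.
apply: le_trans (lerD dense_le (lerD hole_le indep_le)).
apply: le_trans (gnp_prob_orb p01 (A := dense) (B := fun G => hole G || indep G) _) _; last first.
  by rewrite lerD2l; apply: gnp_prob_orb => // G.
move=> G; apply: contraLR; rewrite /= !negb_or => /and3P[noD noH noI].
have small (S : {set 'I_n}) : (#|S| <= m)%N -> (chi (induced G S) <= 4 * k)%N.
  apply: sparse_chi; first by rewrite muln_gt0.
  move=> Y Y0 Ym; rewrite ltnNge; apply: contra noD => YE.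
  by apply/existsP; exists Y; rewrite Y0 Ym.
have free : bipartite_hole_free G a.
  move=> S Y dSY aS aY; move: noH => /existsPn/(_ S)/existsPn/(_ Y).
  rewrite dSY aS aY /= => /forall_inPn[x xS /forall_inPn[y yY]]; rewrite negbK => xy.
  by exists x, y.
have edge (S : {set 'I_n}) : #|S| = q -> exists x y, [/\ x \in S, y \in S & adj G x y].
  move=> Sq; move: noI => /existsPn/(_ S); rewrite Sq eqxx /=.
  move=> /forall_inPn[x xS /forall_inPn[y yS]]; rewrite negbK => xy.
  by exists x, y.
have m0' : (0 < m)%N by case/andP: am => /leq_trans; apply.
(* The upper bound [chiB] serves the size condition of [chi_le_phihat]; the lower bound [chiq]
   converts the loss [8 * k] into a fraction of [chi G]. *)
have chiB := chi_le_blocks m0' small; rewrite card_ord in chiB.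
have chiq := card_le_chi edge; rewrite card_ord in chiq.
have chihat : (chi G <= phihat G + 2 * (4 * k))%N.
  apply: chi_le_phihat am l0 _ aD free small _; first by rewrite card_ord.
  by apply: leq_trans Hm; rewrite leq_add2l leq_mul2r chiB orbT.
rewrite phihat_le_phi /=.
have qr : 0 < q%:R :> R by rewrite ltr0n.
move: chiq chihat; rewrite -!(ler_nat R) natrM natrD mulnA -ler_pdivrMr // => chiq chihat.
have : 4 * 10 ^+ 6 * (n%:R / q%:R) / L <= (chi G)%:R * (4 * 10 ^+ 6 / L).
  rewrite [X in _ <= X]mulrC [X in _ <= X]mulrAC ler_wpM2r ?invr_ge0 ?(ltW L0) //.
  by rewrite ler_wpM2l.
lra.
Qed.

Local Open Scope classical_set_scope.
Local Open Scope ring_scope.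

Theorem theorem4p6 (R : realType) (p : nat -> R)
    (hp : \forall n \near \oo,
       2 * ln (n%:R : R) / n%:R < p n < 1 / (ln (n%:R : R)) ^+ 2) :
  exists2 C : R, 0 < C &
    aas p (fun n (G : sgraph 'I_n) =>
      (phihat G <= phi G)%N &&
      ((chi G)%:R * (1 - C / ln (n%:R * p n)) <= (phihat G)%:R)).
Proof.
(* An absolute constant, the same for every function [p]. *)
exists (4 * 10 ^+ 6); first by rewrite mulr_gt0 ?exprn_gt0.
have ln_large (A : R) : \forall n \near \oo, A <= ln (n%:R : R).
  near=> n; have nA : expR A <= n%:R by near: n; exact: nbhs_infty_ger.
  by rewrite -[A]expRK ler_ln ?posrE ?expR_gt0 // (lt_le_trans _ nA) ?expR_gt0.
apply/cvgrPdist_le => e e0; near=> n.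
have N1 : 1 <= ln (n%:R : R) by near: n; exact: ln_large.
(* As $np > 2 \log n$, this forces $L \ge 10^9 + 3/e$, where [e] is the tolerance: the first summand
   validates the parameters, the second gives $3/L \le e$. *)
have NA : expR (10 ^+ 9 + 3 / e) <= ln (n%:R : R) by near: n; exact: ln_large.
have /andP[pl pu] : 2 * ln (n%:R : R) / n%:R < p n < 1 / (ln (n%:R : R)) ^+ 2.
  by near: n.
have n0 : 0 < n%:R :> R.
  by rewrite ltNge; apply/negP => /ln0 h; move: N1; rewrite h ler10.
have p0 : 0 < p n.
  by apply: lt_trans pl; rewrite divr_gt0 ?mulr_gt0 // (lt_le_trans _ N1).
have N20 : 1 <= ln (n%:R : R) ^+ 2 by rewrite exprn_ege1.
have pn : p n * ln (n%:R : R) ^+ 2 <= 1.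
  by rewrite -ler_pdivlMr ?(lt_le_trans _ N20) // ltW.
have p1 : p n <= 1.
  by apply: le_trans pn; rewrite ler_peMr // ltW.
set L := ln (n%:R * p n).
have eL : 10 ^+ 9 + 3 / e <= L.
  rewrite -[X in X <= _]expRK ler_ln ?posrE ?expR_gt0 ?mulr_gt0 //.
  apply: le_trans NA _; move: pl; rewrite ltr_pdivrMr // => /ltW; rewrite [p n * _]mulrC.
  by apply: le_trans; rewrite ler_peMl ?ler1n // (le_trans _ N1).
have e30 : 0 < 3 / e by rewrite divr_gt0.
have L9 : 10 ^+ 9 <= L by lra.
have p01 : 0 < p n <= 1 by rewrite p0.
have := gnp_phihat_ge p01 pn L9; rewrite -/L.
set P := gnp_prob _ _ => P1.
have P2 : P <= 1.
  by rewrite /P gnp_prob_compl ?(ltW p0) // gerBl gnp_prob_ge0 // (ltW p0).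
rewrite ger0_norm ?subr_ge0 //.
suff : 3 / L <= e by lra.
have L0 : 0 < L by apply: lt_le_trans L9; rewrite exprn_gt0.
rewrite ler_pdivrMr // mulrC -ler_pdivrMr //; lra.
Unshelve. all: by end_near.
Qed.
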